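(* Let $\Omega_1$ be the partial functional on subsets $X\subseteq\mathbb N^{\mathbb N}$ (given by characteristic functions) which is defined exactly when $X=\{x\}$ for some $x\in\mathbb N^{\mathbb N}$, and then $\Omega_1(X)=x$. Then $\Omega_1$ is not computable in any total countably based functional of type rank $3$.
   Context: Types: $0$ is a type of rank $0$; if $\sigma_1,\dots,\sigma_n$ ($n\ge 1$) are types, then $(\sigma_1,\dots,\sigma_n\to 0)$ is a type of rank $\max_i(\mathrm{rank}(\sigma_i)+1)$. Put $F(0)=\mathbb N$ and let $F(\sigma_1,\dots,\sigma_n\to 0)$ be the set of all total functions $F(\sigma_1)\times\cdots\times F(\sigma_n)\to\mathbb N$. Let $P(0)=\mathbb N\cup\{\bot\}$ and let $P(\sigma_1,\dots,\sigma_n\to 0)$ be the set of all functions $F(\sigma_1)\times\cdots\times F(\sigma_n)\to\mathbb N\cup\{\bot\}$, where $\bot$ means undefined (partial functionals, applied only to total arguments). A functional is total if it never takes the value $\bot$. Functionals with values in $\mathbb N^{\mathbb N}$ are viewed as $\mathbb N$-valued functionals with an extra number argument. Computability: Kleene's S1–S9, where partial functionals of type rank $\le 3$ are allowed as oracles. That is, $\{e\}(\vec\phi)\simeq a$ is the least relation closed under Kleene's schemes: successor, constants, projection to a number argument, composition, primitive recursion, permutation of arguments, application of an argument, and S9: $\{e\}(m,\vec\phi,\vec\psi)\simeq\{m\}(\vec\phi)$. An application $\phi_i(\lambda\vec\xi_1.\{d_1\}(\vec\xi_1,\vec\phi),\dots,\lambda\vec\xi_k.\{d_k\}(\vec\xi_k,\vec\phi))$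 has value $a\in\mathbb N$ iff all the displayed functionals are total (on total arguments) and $\phi_i$ applied to them equals $a$. A partial functional $\psi$ is computable in $\vec\phi$ if for some $e$, $\{e\}(\vec\xi,\vec\phi)\simeq\psi(\vec\xi)$ for all total $\vec\xi$ with $\psi(\vec\xi)\ne\bot$. Countably based (total case): let $\Phi\in F(\sigma)$ with $\mathrm{rank}(\sigma)\le 3$, $\sigma=(\tau_1,\dots,\tau_n\to 0)$, $\tau_i=(\delta_{i,1},\dots,\delta_{i,m_i}\to 0)$ with all $\delta_{i,j}$ of rank $\le 1$. $\Phi$ is countably based if for all $F_1,\dots,F_n$ there are countable sets $X_i\subseteq F(\delta_{i,1})\times\cdots\times F(\delta_{i,m_i})$ such that $\Phi(F_1,\dots,F_n)=\Phi(G_1,\dots,G_n)$ whenever $F_i$ and $G_i$ are equal on $X_i$ for each $i$. *)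

(* Defs.v *)
From mathcomp Require Import all_boot.
From mathcomp Require Import boolp classical_sets cardinality.

Set Implicit Arguments.
Unset Strict Implicit.
Unset Printing Implicit Defensive.

Local Open Scope classical_set_scope.

(* [Arr [:: s1; ..; sn]] is the type (s1,..,sn -> 0); the empty list gives
   the base type 0, written [N0]. *)
Inductive ty := Arr of seq ty.

Definition N0 : ty := Arr [::].

Definition dom (s : ty) : seq ty := let: Arr l := s in l.

Fixpoint rank (s : ty) : nat :=
  let: Arr l := s in foldr (fun t m => maxn (rank t).+1 m) 0 l.

(* F(s), in curried form; F N0 is nat. *)
Fixpoint F (s : ty) : Type :=
  let: Arr l := s in foldr (fun t B => F t -> B) nat l.

Definition curried (A : Type) (l : seq ty) : Type :=
  foldr (fun t B => F t -> B) A l.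

(* P(s), with None for "undefined"; arguments are total. *)
Definition P (s : ty) : Type := curried (option nat) (dom s).

(* The product F(s1) x ... x F(sn). *)
Definition args (l : seq ty) : Type := foldr (fun t B => F t * B)%type unit l.

Fixpoint eval (A : Type) (l : seq ty) : curried A l -> args l -> A :=
  match l return curried A l -> args l -> A with
  | [::] => fun a _ => a
  | t :: l' => fun f x => eval (f x.1) x.2
  end.

Definition evalF (s : ty) : F s -> args (dom s) -> nat :=
  match s return F s -> args (dom s) -> nat with
  | Arr l => fun f x => @eval nat l f x
  end.

Definition evalP (s : ty) (f : P s) (x : args (dom s)) : option nat :=
  @eval (option nat) (dom s) f x.

Fixpoint proj (l : seq ty) : args l -> forall i : nat, F (nth N0 l i) :=
  match l return args l -> forall i : nat, F (nth N0 l i) with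
  | [::] => fun _ i =>
      match i return F (nth N0 [::] i) with 0 => 0 | _.+1 => 0 end
  | t :: l' => fun x i =>
      match i return F (nth N0 (t :: l') i) with
      | 0 => x.1
      | j.+1 => proj x.2 j
      end
  end.

Fixpoint curried_map (A B : Type) (h : A -> B) (l : seq ty) :
    curried A l -> curried B l :=
  match l return curried A l -> curried B l with
  | [::] => h
  | t :: l' => fun f x => curried_map h (f x)
  end.

(* The inclusion of F(s) into P(s). *)
Definition tot (s : ty) : F s -> P s :=
  match s return F s -> P s with
  | Arr l => fun f => @curried_map nat (option nat) (@Some nat) l f
  end.

(* Arguments of a computation are finite lists of partial functionals of
   arbitrary types; total functionals (in particular numbers) enter via [tot]. *)
Definition oracle := {s : ty & P s}.

Definition orc (s : ty) (f : P s) : oracle := existT P s f.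

Definition num (n : nat) : oracle := orc (@tot N0 n).

Fixpoint orcs (l : seq ty) : args l -> seq oracle :=
  match l return args l -> seq oracle with
  | [::] => fun _ => [::]
  | t :: l' => fun x => orc (tot x.1) :: orcs x.2
  end.

(* [kleene e phi a] is {e}(phi) ~ a.  An index is a natural number coding a
   sequence whose head is the number of the scheme; an index whose shape does
   not fit the argument list computes nothing.  S6 carries the permutation as
   the list of its values.  In S8 the argument in position i is applied;
   [G] is the tuple of total functionals defined by the indices [ds], so the
   rule applies only if all of these are total.  In S9 the index carries the
   length of the retained list [phi]. *)
Inductive kleene : nat -> seq oracle -> nat -> Prop :=
| S1 x phi :
    kleene (CodeSeq.code [:: 1]) (num x :: phi) x.+1
| S2 q phi :
    kleene (CodeSeq.code [:: 2; q]) phi q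
| S3 x phi :
    kleene (CodeSeq.code [:: 3]) (num x :: phi) x
| S4 d1 d2 phi b a :
    kleene d2 phi b ->
    kleene d1 (num b :: phi) a ->
    kleene (CodeSeq.code [:: 4; d1; d2]) phi a
| S5_zero d1 d2 phi a :
    kleene d1 phi a ->
    kleene (CodeSeq.code [:: 5; d1; d2]) (num 0 :: phi) a
| S5_succ d1 d2 n phi b a :
    kleene (CodeSeq.code [:: 5; d1; d2]) (num n :: phi) b ->
    kleene d2 (num n :: num b :: phi) a ->
    kleene (CodeSeq.code [:: 5; d1; d2]) (num n.+1 :: phi) a
| S6 d p phi a :
    perm_eq p (iota 0 (size phi)) ->
    kleene d (pmap (onth phi) p) a ->
    kleene (CodeSeq.code [:: 6, d & p]) phi a
| S7 (f : P (Arr [:: N0])) x phi a :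
    f x = Some a ->
    kleene (CodeSeq.code [:: 7]) (orc f :: num x :: phi) a
| S8 i ds phi (s : ty) (f : P s) (G : args (dom s)) a :
    onth phi i = Some (orc f) ->
    size ds = size (dom s) ->
    (forall j, j < size (dom s) ->
       forall xi : args (dom (nth N0 (dom s) j)),
       kleene (nth 0 ds j) (orcs xi ++ phi) (evalF (proj G j) xi)) ->
    evalP f G = Some a ->
    kleene (CodeSeq.code [:: 8, i & ds]) phi a
| S9 m phi psi a :
    kleene m phi a ->
    kleene (CodeSeq.code [:: 9; size phi]) (num m :: phi ++ psi) a.

(* [phi] is meant to consist of functionals of rank at most 3, and [psi] to
   have rank at most 3; all argument lists arising in the computation then
   have this property as well. *)
Definition computable_in (s : ty) (psi : P s) (phi : seq oracle) : Prop :=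
  exists e : nat, forall (xi : args (dom s)) (a : nat),
    evalP psi xi = Some a -> kleene e (orcs xi ++ phi) a.

(* Meant for rank s <= 3.  If the i-th argument type is 0, then [X i] is a
   subset of a one-point set. *)
Definition countably_based (s : ty) (Phi : F s) : Prop :=
  forall G : args (dom s),
  exists X : forall i, set (args (dom (nth N0 (dom s) i))),
    (forall i, i < size (dom s) -> countable (X i)) /\
    forall H : args (dom s),
      (forall i, i < size (dom s) ->
         forall xi, X i xi -> evalF (proj G i) xi = evalF (proj H i) xi) ->
      evalF Phi G = evalF Phi H.

Definition ty1 : ty := Arr [:: N0].
Definition ty2 : ty := Arr [:: ty1].

Definition char_fun (A : set (nat -> nat)) : F ty2 :=
  fun x => nat_of_bool `[< A x >].

(* Omega_1 has values in nat -> nat, hence an extra number argument. *)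
Definition Omega1 : P (Arr [:: ty2; N0]) := fun X n =>
  match pselect (exists x : nat -> nat, X = char_fun [set x]) with
  | left ex => Some (projT1 (cid ex) n)
  | right _ => None
  end.

(* Main.v *)
(* Work modulo countable sets of [x : nat -> nat]; [ev Q] says that [Q x] holds for
   all but countably many [x].  If [{e}({x}, Phi, ..) = v x] for almost all [x], the
   other arguments not depending on [x], then [v] is almost everywhere constant.  The
   crucial case is S8: by induction the argument of [Phi] is, at each point, almost
   everywhere constant in [x], which gives a limit functional [G].  As [Phi] is
   countably based at [G] and a countable union of countable sets is countable,
   [Phi] almost always takes the value [Phi G].  Applying [{x}] itself almost always
   gives 0, as [x] almost never equals the limit argument.  Hence a program for
   [Omega_1] would make each [x n] almost everywhere constant in [x], contradicting
   the uncountability of [nat -> nat]. *)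

Require Import Defs.
From Stdlib Require List.
From mathcomp Require Import all_boot.
From mathcomp Require Import boolp classical_sets cardinality.

Set Implicit Arguments.
Unset Strict Implicit.
Unset Printing Implicit Defensive.

Local Open Scope classical_set_scope.

(** * Preliminaries on well-foundedness and oracles *)

(** Dependent choice along inaccessible points. This form serves an order on families of trees that
    has no structural induction of its own. *)
Lemma acc_no_descending (A : Type) (lt : A -> A -> Prop) :
  (forall u : nat -> A, ~ forall n, lt (u n.+1) (u n)) -> well_founded lt.
Proof.
move=> nodesc x; apply: contrapT => nx.
have next (y : {y | ~ Acc lt y}) : {z : {z | ~ Acc lt z} | lt (sval z) (sval y)}.
  case: y => y ny /=; apply: cid; apply: contrapT => nz; apply: ny; constructor=> z zy.
  by apply: contrapT => az; apply: nz; exists (exist _ z az).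
pose u := fix u n := if n is m.+1 then sval (next (u m)) else exist _ x nx.
by apply: (nodesc (fun n => sval (u n))) => n; apply: (svalP (next (u n))).
Qed.

Lemma orc_type (s t : ty) (f : P s) (g : P t) : orc f = orc g -> s = t.
Proof. by move=> /(congr1 (@projT1 _ _)). Qed.

Lemma orc_inj (s : ty) : injective (@orc s).
Proof.
move=> f g fg; have := projT2_eq fg => /=.
by rewrite (Prop_irrelevance (projT1_eq fg) erefl).
Qed.

(** * Properties of almost all sequences *)

Definition ev (Q : (nat -> nat) -> Prop) := countable [set x | ~ Q x].

Lemma ev_mono (Q Q' : (nat -> nat) -> Prop) :
  (forall x, Q x -> Q' x) -> ev Q -> ev Q'.
Proof. by move=> QQ'; apply: sub_countable; apply: subset_card_le => x /= nQ' /QQ'. Qed.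

Lemma ev_all (Q : (nat -> nat) -> Prop) : (forall x, Q x) -> ev Q.
Proof.
move=> allQ; rewrite /ev (_ : [set x | ~ Q x] = set0) //.
by apply/seteqP; split=> x //= /(_ (allQ x)).
Qed.

Lemma ev_forall_in (I : Type) (D : set I) (Q : I -> (nat -> nat) -> Prop) :
  countable D -> (forall i, D i -> ev (Q i)) -> ev (fun x => forall i, D i -> Q i x).
Proof.
move=> cD evQ; have := bigcup_countable cD evQ.
apply: sub_countable; apply: subset_card_le => x /= nQ.
apply: contrapT => nB; apply: nQ => i Di; apply: contrapT => nQ.
by apply: nB; exists i.
Qed.

Lemma ev_forall (I : countType) (Q : I -> (nat -> nat) -> Prop) :
  (forall i, ev (Q i)) -> ev (fun x => forall i, Q i x).
Proof.
move=> evQ; have := @ev_forall_in I setT Q (countableP _) (fun i _ => evQ i).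
by apply: ev_mono => x + i; apply.
Qed.

Lemma ev_and (Q Q' : (nat -> nat) -> Prop) :
  ev Q -> ev Q' -> ev (fun x => Q x /\ Q' x).
Proof.
move=> evQ evQ'; have : ev (fun x => forall b : bool, (if b then Q else Q') x).
  by apply: (@ev_forall bool (fun b => if b then Q else Q')); case.
by apply: ev_mono => x H; split; [apply: (H true)|apply: (H false)].
Qed.

(** The witness becomes a function of [x]; [a0] is its value where no witness exists. *)
Lemma ev_choice (A : Type) (a0 : A) (Q : (nat -> nat) -> A -> Prop) :
  ev (fun x => exists a, Q x a) -> exists f, ev (fun x => Q x (f x)).
Proof.
move=> evQ.
have [f fP] : {f & forall x, (exists a, Q x a) -> Q x (f x)}.
  apply: (@choice _ _ (fun x a => (exists a, Q x a) -> Q x a)) => x.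
  case: (pselect (exists a, Q x a)) => [[a Qa]|nQ].
    by exists a.
  by exists a0.
by exists f; apply: ev_mono evQ.
Qed.

Lemma ev_neq (g : nat -> nat) : ev (fun x => x <> g).
Proof.
have := countable1 g; apply: sub_countable; apply: subset_card_le => x /=.
by move=> /contrapT.
Qed.

Lemma ev_ex (Q : (nat -> nat) -> Prop) : ev Q -> exists x, Q x.
Proof.
move=> evQ; apply: contrapT => nQ.
have cT : countable [set: nat -> nat].
  by apply: sub_countable evQ; apply: subset_card_le => x _ /= Qx; apply: nQ; exists x.
have /pcard_injP[f f_inj] := cT.
(* Diagonal sequence: one more than the [n]-th value of the sequence with code [n], and 1 where [n]
   is no code. *)
pose x n := (if pselect (exists2 y : nat -> nat, f y = n & True) is left ex
             then s2val (cid2 ex) n else 0).+1.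
have : x (f x) = (x (f x)).+1.
  rewrite {1}/x; case: pselect => [ex|[]]; last by exists x.
  case: (cid2 ex) => /= y fy _.
  by rewrite (f_inj y x _ _ fy) ?inE.
by apply: n_Sn.
Qed.

Definition evconst (v : (nat -> nat) -> nat) := exists a, ev (fun x => v x = a).

(** Uncountability of the space refutes the hypothesis; this disposes of indices whose shape fits no
    scheme. *)
Lemma evconst_false (v : (nat -> nat) -> nat) :
  ev (fun=> False) -> evconst v.
Proof. by move=> /ev_ex[]. Qed.

Lemma rank_nth (l : seq ty) (j : nat) :
  j < size l -> rank (nth N0 l j) < rank (Arr l).
Proof.
elim: l j => [|t l IH] [|j] //= jl; rewrite leq_max ?leqnn //.
by rewrite -/(rank (Arr l)) IH ?orbT.
Qed.

Lemma rank_nth_pred (s : ty) (j : nat) : rank (nth N0 (dom s) j) <= (rank s).-1.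
Proof.
case: s => l; case: (ltnP j (size l)) => jl; last by rewrite /= nth_default.
by have := rank_nth jl; case: (rank (Arr l)).
Qed.

Lemma rank_eq0 (s : ty) : rank s = 0 -> s = N0.
Proof. by case: s => -[|t l] //= /eqP; rewrite -leqn0 geq_max. Qed.

(** An intermediate value chosen for each [x] is itself almost everywhere constant, so a single
    number serves for almost all [x]. *)
Lemma ev_pull (Q Q' : nat -> (nat -> nat) -> Prop) :
    (forall w : (nat -> nat) -> nat, ev (fun x => Q' (w x) x) -> evconst w) ->
  ev (fun x => exists b, Q' b x /\ Q b x) -> exists b, ev (Q b).
Proof.
move=> Qconst /(ev_choice 0)[w evw].
have [|b evb] := Qconst w; first by apply: ev_mono evw => x [].
by exists b; apply: ev_mono (ev_and evb evw) => x [<- []].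
Qed.

(** * Currying and tuples of functionals *)

Fixpoint curry (l : seq ty) : (args l -> nat) -> curried nat l :=
  match l with
  | [::] => fun h => h tt
  | t :: l' => fun h x => curry (fun y : args l' => h (x, y))
  end.

Lemma eval_curry (l : seq ty) (h : args l -> nat) (x : args l) : eval (curry h) x = h x.
Proof. by elim: l h x => [|t l IH] h /= [] //= y z; rewrite IH. Qed.

Definition curryF (s : ty) : (args (dom s) -> nat) -> F s :=
  match s with Arr l => @curry l end.

Lemma evalF_curryF (s : ty) (h : args (dom s) -> nat) (x : args (dom s)) :
  evalF (curryF h) x = h x.
Proof. by case: s h x => l h x; apply: eval_curry. Qed.

Lemma evalF_ext (s : ty) (f g : F s) : evalF f =1 evalF g -> f = g.
Proof.
case: s f g => l; elim: l => [|t l IH] /= f g fg; first exact: (fg tt).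
by apply: funext => x; apply: IH => y; apply: (fg (x, y)).
Qed.

Lemma evalP_tot (s : ty) (f : F s) (x : args (dom s)) : evalP (tot f) x = Some (evalF f x).
Proof.
by case: s f x => l; rewrite /evalP; elim: l => [|t l IH] //= f [y z]; apply: IH.
Qed.

Fixpoint mkargs (l : seq ty) : (forall j, args (dom (nth N0 l j)) -> nat) -> args l :=
  match l with
  | [::] => fun _ => tt
  | t :: l' => fun h => (curryF (h 0), mkargs (fun j => h j.+1))
  end.

Lemma proj_mkargs (l : seq ty) (h : forall j, args (dom (nth N0 l j)) -> nat)
    (j : nat) (xi : args (dom (nth N0 l j))) :
  j < size l -> evalF (proj (mkargs h) j) xi = h j xi.
Proof.
elim: l h j xi => [|t l IH] h [|j] //= xi jl; first exact: evalF_curryF.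
exact: (IH (fun j => h j.+1)).
Qed.

Lemma args_ext (l : seq ty) (G H : args l) :
  (forall j, j < size l -> evalF (proj G j) =1 evalF (proj H j)) -> G = H.
Proof.
elim: l G H => [|t l IH] /=; first by move=> [] [].
move=> [g G] [h H] GH.
congr pair; first exact: evalF_ext (GH 0 isT).
by apply: IH => j; apply: (GH j.+1).
Qed.

(** * Countably based functionals and stable families *)

Lemma countably_based_rank1 (s : ty) (f : F s) : rank s <= 1 -> countably_based f.
Proof.
move=> s1 G; exists (fun=> setT); split=> [i _|H GH].
  (* All arguments have type 0, whose only point is the empty tuple. *)
  have /rank_eq0-> : rank (nth N0 (dom s) i) = 0.
    by apply/eqP; rewrite -leqn0 (leq_trans (rank_nth_pred s i)) // -subn1 leq_subLR.
  exact: countableP.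
by congr evalF; apply: args_ext => j jl xi; apply: GH.
Qed.

(* Preservation of eventual pointwise constancy, the property of [fun=> Phi] and
   of [x |-> char_fun [set x]] that makes the S8 case of [step_const] work. *)
Definition stable (s : ty) (f : (nat -> nat) -> P s) :=
  forall (G : (nat -> nat) -> args (dom s)) (v : (nat -> nat) -> nat),
    (forall j, j < size (dom s) -> forall xi, evconst (fun x => evalF (proj (G x) j) xi)) ->
    ev (fun x => evalP (f x) (G x) = Some (v x)) -> evconst v.

Lemma stable_tot (s : ty) (f : F s) : countably_based f -> stable (fun=> tot f).
Proof.
move=> cbf G v Gconst.
(* The range condition stands inside the existential because [mkargs] wants a component at every
   index. *)
have Gconst' j xi : exists a, j < size (dom s) -> ev (fun x => evalF (proj (G x) j) xi = a).
  by case: (ltnP j (size (dom s))) => [/Gconst/(_ xi)[a aP]|_]; [exists a|exists 0].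
pose G0 := mkargs (fun j xi => projT1 (cid (Gconst' j xi))).
have [X [Xc GX]] := cbf G0; move=> evv; exists (evalF f G0).
have : ev (fun x => forall j, j < size (dom s) ->
    forall xi, X j xi -> evalF (proj G0 j) xi = evalF (proj (G x) j) xi).
  apply: ev_forall => j; case: (ltnP j (size (dom s))) => jl; last exact: ev_all.
  have := ev_forall_in (Xc j jl) (fun xi _ => projT2 (cid (Gconst' j xi)) jl).
  by apply: ev_mono => x H _ xi Xxi; rewrite proj_mkargs // H.
move=> /(ev_and evv); apply: ev_mono => x [+ /GX ->].
by rewrite evalP_tot => -[].
Qed.

Lemma stable_char_fun : stable (fun x => @tot ty2 (char_fun [set x])).
Proof.
move=> G v Gconst evv; exists 0.
(* [g] is the limit of the argument; as there are only countably many [n], the argument equals [g]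
   for almost all [x]. *)
have /choice[g gP] (n : nat) : exists a, ev (fun x => (G x).1 n = a).
  exact: (Gconst 0 isT (n, tt)).
apply: ev_mono (ev_and evv (ev_and (ev_forall gP) (ev_neq g))) => x [+ [Gx xg]].
rewrite evalP_tot => -[<-] /=; rewrite /char_fun; case: asboolP => //= Gxx.
by case: xg; rewrite -Gxx; apply: funext.
Qed.

(** * Argument lists depending on a sequence *)

Definition good (t : (nat -> nat) -> oracle) :=
  exists s (f : (nat -> nat) -> P s),
    [/\ rank s <= 3, forall x, t x = orc (f x) & stable f].

Lemma good_tot (s : ty) (f : F s) : rank s <= 1 -> good (fun=> orc (tot f)).
Proof.
move=> s1; exists s, (fun=> tot f); split=> //; first exact: leq_trans s1 _.
exact/stable_tot/countably_based_rank1.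
Qed.

(** Stability at type 0 has no arguments to test, so it is constancy outright. This fixes the number
    on which S5 recurses and the index that S9 reads. *)
Lemma good_num (t : (nat -> nat) -> oracle) (Q : nat -> (nat -> nat) -> Prop) :
  good t -> ev (fun x => exists n, t x = num n /\ Q n x) -> exists n, ev (Q n).
Proof.
move=> [s [f [_ tE fst]]]; apply: ev_pull => w evw.
have [x0] := ev_ex evw; rewrite tE => /orc_type sE; subst s.
apply: (fst (fun=> tt)) => //; apply: ev_mono evw => x.
by rewrite tE => /orc_inj ->.
Qed.

Definition inst (phi : seq ((nat -> nat) -> oracle)) (x : nat -> nat) : seq oracle :=
  [seq t x | t <- phi].

Definition csts (l : seq oracle) : seq ((nat -> nat) -> oracle) := [seq (fun=> o) | o <- l].

Lemma inst_csts (l : seq oracle) (phi : seq ((nat -> nat) -> oracle)) (x : nat -> nat) :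
  inst (csts l ++ phi) x = l ++ inst phi x.
Proof. by elim: l => //= o l IH; congr cons. Qed.

Lemma good_orcs (l : seq ty) (xi : args l) (phi : seq ((nat -> nat) -> oracle)) :
    (forall j, rank (nth N0 l j) <= 1) -> List.Forall good phi ->
  List.Forall good (csts (orcs xi) ++ phi).
Proof.
move=> + gphi; elim: l xi => [|t l IH] //= [y z] rl.
constructor; first exact: (good_tot _ (rl 0)).
by apply: IH => j; apply: (rl j.+1).
Qed.

Lemma good_onth (phi : seq ((nat -> nat) -> oracle)) (i : nat) t :
  List.Forall good phi -> onth phi i = Some t -> good t.
Proof.
move=> gphi; elim: gphi i => [|u psi gu _ IH] [|i] //=; first by move=> [<-].
exact: IH.
Qed.

Lemma good_pmap (phi : seq ((nat -> nat) -> oracle)) (p : seq nat) :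
  List.Forall good phi -> List.Forall good (pmap (onth phi) p).
Proof.
move=> gphi; elim: p => //= i p IH.
by case E: (onth phi i) => [t|] //=; constructor=> //; apply: good_onth E.
Qed.

Lemma pmap_inst (phi : seq ((nat -> nat) -> oracle)) (p : seq nat) (x : nat -> nat) :
  pmap (onth (inst phi x)) p = inst (pmap (onth phi) p) x.
Proof. by elim: p => //= i p IH; rewrite onth_map IH; case: (onth phi i). Qed.

(* One unfolding of the rules of [kleene], with [K] for the premises; the
   permutation condition of S6 and the size condition of S8 are dropped. *)
Definition step (K : nat -> seq oracle -> nat -> Prop) (e : nat) (phi : seq oracle)
    (a : nat) : Prop :=
  match CodeSeq.decode e with
  | [:: 1] => exists x phi', phi = num x :: phi' /\ a = x.+1
  | [:: 2; q] => a = q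
  | [:: 3] => exists x phi', phi = num x :: phi' /\ a = x
  | [:: 4; d1; d2] => exists b, K d2 phi b /\ K d1 (num b :: phi) a
  | [:: 5; d1; d2] => exists n phi', phi = num n :: phi' /\
      match n with
      | 0 => K d1 phi' a
      | m.+1 => exists b, K e (num m :: phi') b /\ K d2 (num m :: num b :: phi') a
      end
  | [:: 6, d & p] => K d (pmap (onth phi) p) a
  | [:: 7] => exists (f : P ty1) x phi', phi = orc f :: num x :: phi' /\ f x = Some a
  | [:: 8, i & ds] => exists (s : ty) (f : P s) (G : args (dom s)),
      [/\ onth phi i = Some (orc f),
          forall j, j < size (dom s) -> forall xi : args (dom (nth N0 (dom s) j)),
            K (nth 0 ds j) (orcs xi ++ phi) (evalF (proj G j) xi) &
          evalP f G = Some a]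
  | [:: 9; k] => exists m phi', phi = num m :: phi' /\ K m (take k phi') a
  | _ => False
  end.

(** * Constancy passes through each scheme *)

(** [K] varies with [x], as derivations do, while the index and the list of argument families are
    common to all [x]. *)
Lemma step_const (K : (nat -> nat) -> nat -> seq oracle -> nat -> Prop) :
    (forall e phi v, List.Forall good phi ->
       ev (fun x => K x e (inst phi x) (v x)) -> evconst v) ->
  forall e phi v, List.Forall good phi ->
    ev (fun x => step (K x) e (inst phi x) (v x)) -> evconst v.
Proof.
move=> Kconst e phi v gphi; rewrite /step.
have gnum n psi : List.Forall good psi -> List.Forall good ((fun=> num n) :: psi).
  by constructor=> //; apply: (@good_tot N0).
(* S1, S3, S5 and S9 read a number at the head of the list; [good_num] makes it the same for almost
   all [x]. *)
have headnum (Q : nat -> seq oracle -> (nat -> nat) -> Prop) :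
    ev (fun x => exists n phi', inst phi x = num n :: phi' /\ Q n phi' x) ->
    exists n phi', List.Forall good phi' /\ ev (fun x => Q n (inst phi' x) x).
  case: gphi => [/ev_ex[x [n [phi' []]]] //|t psi gt gpsi evQ].
  have [|n evn] := @good_num t (fun n x => Q n (inst psi x) x) gt.
    by apply: ev_mono evQ => x [n [phi' [[-> ->] ?]]]; exists n.
  by exists n, psi.
have pull d psi (Q : nat -> (nat -> nat) -> Prop) : List.Forall good psi ->
    ev (fun x => exists b, K x d (inst psi x) b /\ Q b x) -> exists b, ev (Q b).
  by move=> gpsi; apply: ev_pull => w; apply: Kconst.
have evF := @evconst_false v.
case: (CodeSeq.decode e) => [//|k l].
case: k => [//|[|[|[|[|[|[|[|[|[|//]]]]]]]]]].
- case: l => [|//] /(headnum (fun n _ x => v x = n.+1))[n [_ [_ evn]]].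
  by exists n.+1.
- by case: l => [//|q [|//]] evq; exists q.
- case: l => [|//] /(headnum (fun n _ x => v x = n))[n [_ [_ evn]]].
  by exists n.
- case: l => [//|d1 [//|d2 [|//]]] /(pull d2 phi) [] // b.
  by apply: (Kconst d1 ((fun=> num b) :: phi)); apply: gnum.
(* S5: the recursive call at [m] is itself a premise, under the same index [e], so no induction on
   the number is needed. *)
- case: l => [//|d1 [//|d2 [|//]]].
  move=> /(headnum (fun n psi x => match n with
      | 0 => K x d1 psi (v x)
      | m.+1 => exists b, K x e (num m :: psi) b /\ K x d2 (num m :: num b :: psi) (v x)
      end))[[|m] [psi [gpsi]]]; first exact: Kconst.
  move=> /(pull e ((fun=> num m) :: psi)) [] //; first exact: gnum.
  by move=> b; apply: (Kconst d2 [:: fun=> num m, fun=> num b & psi]); apply/gnum/gnum.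
- case: l => [//|d p] evK; apply: (Kconst d (pmap (onth phi) p)); first exact: good_pmap.
  by apply: ev_mono evK => x; rewrite pmap_inst.
(* S7: the type of the head is read off at one point, and the number is almost always a fixed [n];
   stability then applies to the constant tuple [(n, tt)]. *)
- case: l => [|//].
  case: gphi => [/ev_ex[x [f [n [phi' []]]]] //|t psi [s [f [_ tE fst]]] gpsi].
  case: gpsi => [/ev_ex[x [g [n [phi' []]]]] //|u psi' gu _ evf].
  have sE : s = ty1.
    by have [x [g [n [phi' [/= [] + _]]]]] := ev_ex evf; rewrite tE => /orc_type.
  subst s; have [n evn] : exists n, ev (fun x => f x n = Some (v x)).
    apply: (good_num gu); apply: ev_mono evf => x [g [n [phi' [/=[] + ux _ gn]]]].
    by rewrite tE => /orc_inj fg; exists n; rewrite fg.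
  apply: (fst (fun=> (n, tt))) evn => -[|//] _ xi.
  by exists n; apply: ev_all.
- case: l => [//|i ds] evS.
  case E: (onth phi i) => [t|]; last first.
    apply: evconst_false; apply: ev_mono evS => x [s [f [G []]]].
    by rewrite onth_map E.
  have [s [f [s3 tE fst]]] := good_onth gphi E.
  have : ev (fun x => exists G : args (dom s),
      (forall j, j < size (dom s) -> forall xi : args (dom (nth N0 (dom s) j)),
        K x (nth 0 ds j) (orcs xi ++ inst phi x) (evalF (proj G j) xi)) /\
      evalP (f x) G = Some (v x)).
    apply: ev_mono evS => x [s' [f' [G []]]].
    rewrite onth_map E /= => /Some_inj; rewrite tE => ff'.
    have ss' := orc_type ff'; subst s'; rewrite (orc_inj ff') => KG fG.
    by exists G.
  (* The argument tuple becomes a function of [x], with zero functionals as default; [Kconst] at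
     each fixed [xi] makes it pointwise almost everywhere constant. *)
  move=> /(ev_choice (mkargs (fun _ _ => 0)))[G evG].
  apply: (fst G) => [j jl xi|]; last by apply: ev_mono evG => x [].
  apply: (Kconst (nth 0 ds j) (csts (orcs xi) ++ phi)).
    (* Rank at most 3 for the applied oracle leaves rank at most 1 for the variables in [xi], so
       they are good as constants. *)
    apply: good_orcs => // m; apply: leq_trans (rank_nth_pred _ _) _.
    by have := leq_trans (rank_nth jl) (_ : rank (Arr (dom s)) <= 3);
       case: s {f fst tE G evG xi jl} s3 => l s3 /(_ s3); case: rank.
  by apply: ev_mono evG => x [KG _]; rewrite inst_csts; apply: KG.
- case: l => [//|k [|//]].
  move=> /(headnum (fun m psi x => K x m (take k psi) (v x)))[m [psi [gpsi evm]]].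
  apply: (Kconst m (take k psi)).
    by move: gpsi; rewrite -{1}(cat_take_drop k psi) => /List.Forall_app[].
  by apply: ev_mono evm => x; rewrite /inst map_take.
Qed.

(** * Derivations bounded by well-founded trees *)

(** Trees replace ordinal heights: the children of a node bound the derivations of the premises.
    Induction on [kleene] would treat one [x] at a time, whereas all [x] must descend together. *)
Inductive tree := leaf | node of (nat -> seq oracle -> nat -> tree).

Definition child (t' t : tree) : Prop :=
  match t with
  | leaf => False
  | node c => exists e phi a, t' = c e phi a
  end.

Lemma child_wf : well_founded child.
Proof.
elim=> [|c IH]; constructor=> t' /=; first by case.
move=> [e [phi [a ->]]]; exact: IH.
Qed.

Fixpoint der (t : tree) (e : nat) (phi : seq oracle) (a : nat) : Prop :=
  match t with
  | leaf => False
  | node c => step (fun e' phi' a' => der (c e' phi' a') e' phi' a') e phi a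
  end.

Lemma kleene_der (e : nat) (phi : seq oracle) (a : nat) :
  kleene e phi a -> exists t, der t e phi a.
Proof.
(* A tree is chosen for every derivable triple at once, so [node c0] bounds whatever follows in one
   step from derivable premises. *)
pose c0 e phi a :=
  if pselect (exists t, der t e phi a) is left ex then projT1 (cid ex) else leaf.
pose K e phi a := der (c0 e phi a) e phi a.
have c0P e' phi' a' : (exists t, der t e' phi' a') -> K e' phi' a'.
  by rewrite /K /c0 => ex; case: pselect => // ex'; apply: (projT2 (cid ex')).
have stepK e' phi' a' : step K e' phi' a' -> exists t, der t e' phi' a'.
  by exists (node c0).
elim=> {e phi a}.
- by move=> x phi; apply: stepK; rewrite /step CodeSeq.codeK; exists x, phi.
- by move=> q phi; apply: stepK; rewrite /step CodeSeq.codeK.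
- by move=> x phi; apply: stepK; rewrite /step CodeSeq.codeK; exists x, phi.
- move=> d1 d2 phi b a _ /c0P Kb _ /c0P Ka.
  by apply: stepK; rewrite /step CodeSeq.codeK; exists b.
- move=> d1 d2 phi a _ /c0P Ka.
  by apply: stepK; rewrite /step CodeSeq.codeK; exists 0, phi.
- move=> d1 d2 n phi b a _ /c0P Kb _ /c0P Ka.
  by apply: stepK; rewrite /step CodeSeq.codeK; exists n.+1, phi; split=> //; exists b.
- move=> d p phi a _ _ /c0P Ka.
  by apply: stepK; rewrite /step CodeSeq.codeK.
- move=> f x phi a fx.
  by apply: stepK; rewrite /step CodeSeq.codeK; exists f, x, phi.
- move=> i ds phi s f G a phi_i _ _ IH fG.
  apply: stepK; rewrite /step CodeSeq.codeK; exists s, f, G; split=> // j jl xi.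
  exact/c0P/IH.
- move=> m phi psi a _ /c0P Ka.
  apply: stepK; rewrite /step CodeSeq.codeK; exists m, (phi ++ psi).
  by rewrite take_size_cat.
Qed.

(* A descending sequence of families of trees would, outside a countable union
   of countable sets, be a descending sequence of trees. *)
Lemma ev_child_wf :
  well_founded (fun T' T : (nat -> nat) -> tree => ev (fun x => child (T' x) (T x))).
Proof.
apply: acc_no_descending => u /ev_forall/ev_ex[x ux].
have : forall t, Acc child t -> forall n, u n x <> t.
  move=> t; elim=> {}t _ IH n un.
  by apply: (IH _ _ n.+1 erefl); rewrite -un.
by move=> /(_ _ (child_wf (u 0 x)) 0); apply.
Qed.

Lemma der_const (T : (nat -> nat) -> tree) (e : nat) phi (v : (nat -> nat) -> nat) :
  List.Forall good phi -> ev (fun x => der (T x) e (inst phi x) (v x)) -> evconst v.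
Proof.
elim/(well_founded_ind ev_child_wf): T e phi v => T IH e phi v gphi evT.
pose K x e phi a := if T x is node c then der (c e phi a) e phi a else False.
apply: (@step_const K _ e phi v gphi); last first.
  by apply: ev_mono evT => x; rewrite /K; case: (T x).
move=> e' phi' v' gphi' evK.
(* At each [x] the subtree for the value [v' x]; by [evK] the tree [T x] is a node for almost all
   [x], so the default [leaf] is harmless. *)
pose T' x := if T x is node c then c e' (inst phi' x) (v' x) else leaf.
apply: (IH T' _ e' phi' v' gphi').
  apply: ev_mono evK => x; rewrite /K /T'; case: (T x) => //= c _.
  by exists e', (inst phi' x), (v' x).
by apply: ev_mono evK => x; rewrite /K /T'; case: (T x).
Qed.

Lemma kleene_const (e : nat) phi (v : (nat -> nat) -> nat) :
  List.Forall good phi -> ev (fun x => kleene e (inst phi x) (v x)) -> evconst v.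
Proof.
move=> gphi evk.
have [|T] := @ev_choice tree leaf (fun x t => der t e (inst phi x) (v x)).
  by apply: ev_mono evk => x; apply: kleene_der.
exact: der_const.
Qed.

(** * Application to [Omega1] *)

Lemma Omega1_set1 (x : nat -> nat) (n : nat) : Omega1 (char_fun [set x]) n = Some (x n).
Proof.
rewrite /Omega1; case: pselect => [ex|[]]; last by exists x.
congr (Some (_ n)); case: (cid ex) => y /= /(congr1 (fun X : F ty2 => X x)).
rewrite /char_fun; case: (asboolP ([set x] x)) => [_|/(_ erefl)//].
by case: asboolP => //= ->.
Qed.

Theorem theorem3p28 (s : ty) (Phi : F s) (hs : rank s = 3)
    (hPhi : countably_based Phi) :
  ~ computable_in Omega1 [:: orc (tot Phi)].
Proof.
move=> [e eP].
have vconst (n : nat) : evconst (fun x => x n).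
  apply: (@kleene_const e [:: fun x => orc (@tot ty2 (char_fun [set x])),
                             fun=> num n & [:: fun=> orc (tot Phi)]]).
    constructor.
      exists ty2, (fun x => @tot ty2 (char_fun [set x])).
      by split=> //; apply: stable_char_fun.
    constructor; first exact: (@good_tot N0).
    constructor; last by [].
    by exists s, (fun=> tot Phi); split; rewrite ?hs //; apply: stable_tot.
  apply: ev_all => x.
  exact: (eP (char_fun [set x], (n, tt)) (x n) (Omega1_set1 x n)).
(* The almost sure values of all [x n] form one sequence [g], and almost every [x] would equal
   it. *)
have [g gP] := choice vconst.
have [x [xg []]] := ev_ex (ev_and (ev_forall gP) (ev_neq g)).
exact: funext.
Qed.
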